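(* Let $R>0$, and for each $\mu\in\mathbb{N}$ let $f_\mu(z)=\sum_{n=0}^{+\infty}a_n(\mu)z^n$, with coefficients $a_n(\mu)\in\mathbb{C}$, be a power series convergent in $D(0;R)$. Suppose that, for each $\rho$ with $0<\rho<R$, the series $\sum_{\mu=0}^{+\infty}f_\mu$ converges uniformly in $\overline{D}(0;\rho)$, and let $F(z)=\sum_{\mu=0}^{+\infty}f_\mu(z)$ for $z\in D(0;R)$. Then for all $z\in D(0;R)$ and all $k\in\mathbb{N}$ we have (all series appearing being convergent) $$F(z)=\sum_{n=0}^{+\infty}\Big(\sum_{\mu=0}^{+\infty}a_n(\mu)\Big)z^n\quad\text{and}\quad F^{(k)}(z)=\sum_{\mu=0}^{+\infty}f_\mu^{(k)}(z),$$ with uniform convergence in every closed disk $\overline{D}(0;\rho)$, where $0<\rho<R$.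
   Context: $\mathbb{N}=\{0,1,2,\dots\}$, $D(0;R)=\{z\in\mathbb{C}:|z|<R\}$, $\overline{D}(0;\rho)=\{z\in\mathbb{C}:|z|\le\rho\}$, and $g^{(k)}$ denotes the $k$-th complex derivative of $g$. *)

(* Defs.v *)
From mathcomp Require Import all_boot all_order all_algebra.
From mathcomp Require Import all_classical all_reals all_analysis.
From mathcomp Require Import complex.

Set Implicit Arguments.
Unset Strict Implicit.
Unset Printing Implicit Defensive.

Import Order.TTheory GRing.Theory Num.Theory.
Import numFieldNormedType.Exports.
Local Open Scope complex_scope.
Local Open Scope ring_scope.
Local Open Scope classical_set_scope.

(* The carrier is written [R[i]^o] because the normed-module, hence
   topological, structure of the field [R[i]] over itself is attached to the
   regular module; [k]-fold [derive1] on it is the complex derivative. *)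

(* The modulus [`|z|] is an element of [R[i]], so the real radius is injected
   there by [_%:C]. *)
Definition open_disk (R : realType) (r : R) : set R[i]^o :=
  [set z | `|z| < r%:C].

Definition closed_disk (R : realType) (rho : R) : set R[i]^o :=
  [set z | `|z| <= rho%:C].

Definition uniform_sum_on (R : realType) (A : set R[i]^o)
    (u : nat -> R[i]^o -> R[i]^o) (S : R[i]^o -> R[i]^o) : Prop :=
  {uniform A, (fun N z => series (u ^~ z) N) @ \oo --> S}.

Definition uniformly_summable_on (R : realType) (A : set R[i]^o)
    (u : nat -> R[i]^o -> R[i]^o) : Prop :=
  exists S, uniform_sum_on A u S.

(* Main.v *)
Require Import Defs.
From mathcomp Require Import all_boot all_order all_algebra.
From mathcomp Require Import all_classical all_reals all_analysis.
From mathcomp Require Import complex.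
From mathcomp Require Import zify ring lra.

(** Weierstrass's double series theorem, proved by turning every statement
    about functions on disks into one about coefficient sequences.

    The bridge from functions to coefficients is Cauchy's estimate
    [|c_n| rho^n <= sup_(|z| <= rho) |g z|] for a power series [g] of
    coefficients [c] ([cauchy_estimate]).  It needs no contour integral: for a
    polynomial of degree less than [m], the coefficient [c_n rho^n] is the
    average of [p (rho w^j) w^(-nj)] over the powers of a primitive root of
    unity [w] of order at least [m], and the general case follows by
    truncation.  Applied to the differences of the partial sums
    [f_0 + ... + f_(N-1)], it shows that their coefficients converge, and that
    the error tends to [0] in each seminorm [sup_n |c_n| rho^n] with
    [rho < r] ([uniform_cvg_coef_cvg]).

    This mode of convergence, [coef_cvg], has two features that give everything
    else.  First, it implies uniform convergence of the sums on smaller closed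
    disks, by comparison with a geometric series ([coef_cvg_uniform]).  Second,
    it is preserved by the formal derivative, because
    [(n+1) t^n <= rho^(n+1) / (rho - t)] for [t < rho] ([coef_cvg_derived]).
    Since a power series is differentiable term by term
    ([power_sum_on_derive]), the [k]-th derivatives of the partial sums and of
    [F] are the sums of the [k]-th formal derivatives, and the statement for
    [k] is the statement for [0] applied to those. *)

Import Order.TTheory GRing.Theory Num.Theory.
Import numFieldNormedType.Exports.
Local Open Scope complex_scope.
Local Open Scope ring_scope.
Local Open Scope classical_set_scope.

Set Implicit Arguments.
Unset Strict Implicit.

Local Notation normc := ComplexField.Normc.normc.
Local Notation normcM := ComplexField.Normc.normcM.
Local Notation normc0 := ComplexField.Normc.normc0.
Local Notation Re := (@complex.Re _).
Local Notation Im := (@complex.Im _).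

(** * The modulus as a real number, and limits of complex sequences *)

(** The norm of [R[i]] takes its values in [R[i]], where the order is partial;
    estimates are carried out in [R] with [normc] instead. *)
Lemma normr_normc (R : realType) (z : R[i]^o) : `|z| = (normc z)%:C.
Proof. by []. Qed.

Lemma normc_ge0 (R : realType) (z : R[i]^o) : 0 <= normc z.
Proof. by rewrite -lecR -normr_normc normr_ge0. Qed.

Lemma normcX (R : realType) (z : R[i]^o) n : normc (z ^+ n) = normc z ^+ n.
Proof.
elim: n => [|n IH]; first by rewrite !expr0 ComplexField.Normc.normc1.
by rewrite !exprS normcM IH.
Qed.

Lemma normc_real (R : realType) (x : R) : 0 <= x -> normc x%:C = x.
Proof. by move=> x0; apply: (@complexI R); rewrite -normr_normc ger0_norm ?lecR. Qed.

Lemma normc_nat (R : realType) n : normc (n%:R : R[i]) = n%:R.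
Proof. by apply: (@complexI R); rewrite -normr_normc normr_nat rmorph_nat. Qed.

Lemma normc_distC (R : realType) (x y : R[i]^o) : normc (x - y) = normc (y - x).
Proof. by rewrite -(normcN (x - y)) opprB. Qed.

Lemma normc_triangle (R : realType) (y x z : R[i]^o) :
  normc (x - z) <= normc (x - y) + normc (y - z).
Proof. by rewrite (le_trans _ (le_normcD _ _))// addrA subrK. Qed.

Lemma normc_sum (R : realType) (I : Type) (s : seq I) (u : I -> R[i]^o) :
  normc (\sum_(i <- s) u i) <= \sum_(i <- s) normc (u i).
Proof.
elim/big_rec2: _ => [|i x y _ le_yx]; first by rewrite normc0.
by rewrite (le_trans (le_normcD _ _))// lerD2l.
Qed.

Lemma normc_le_ReIm (R : realType) (z : R[i]^o) :
  [/\ `|Re z| <= normc z, `|Im z| <= normc z & normc z <= `|Re z| + `|Im z|].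
Proof.
case: z => x y /=; split.
- by rewrite -sqrtr_sqr ler_wsqrtr// lerDl sqr_ge0.
- by rewrite -sqrtr_sqr ler_wsqrtr// lerDr sqr_ge0.
- rewrite -[leRHS]ger0_norm ?addr_ge0// -sqrtr_sqr ler_wsqrtr//.
  rewrite sqrrD !real_normK ?num_real//; have := normr_ge0 x.
  have := normr_ge0 y; nra.
Qed.

(* Otherwise [/=] unfolds the modulus of a concrete number into a square root. *)
Local Arguments ComplexField.Normc.normc : simpl never.

Lemma cvg_normcP (R : realType) (u : nat -> R[i]^o) (l : R[i]^o) :
  u @ \oo --> l <->
  forall e : R, 0 < e -> \forall N \near \oo, normc (l - u N) <= e.
Proof.
split=> [/cvgrPdist_le ul e e0|ul].
  have /ul : 0 < e%:C :> R[i] by rewrite ltcR.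
  by apply: filterS => N; rewrite normr_normc lecR.
apply/cvgrPdist_le => -[e e']; rewrite ltcE /= => /andP[/eqP -> /ul].
by apply: filterS => N; rewrite normr_normc -lecR.
Qed.

Lemma uniform_sum_onP (R : realType) (A : set R[i]^o)
    (u : nat -> R[i]^o -> R[i]^o) (S : R[i]^o -> R[i]^o) :
  uniform_sum_on A u S <->
  forall e : R, 0 < e -> \forall N \near \oo,
    forall z, A z -> normc (S z - series (u ^~ z) N) <= e.
Proof.
split=> [uS e e0|uS P].
  have e0' : 0 < e%:C :> R[i] by rewrite ltcR.
  have /uS : nbhs (S : {uniform` A -> R[i]^o})
      [set h | forall z, A z -> normc (S z - h z) <= e].
    apply/uniform_nbhs; exists [set xy | `|xy.1 - xy.2| < e%:C]; split.
      by rewrite -entourage_ballE; exists e%:C.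
    by move=> h hS z /hS /=; rewrite normr_normc ltcR => /ltW.
  exact.
rewrite uniform_nbhs => -[E [entE EP]].
move: entE; rewrite -entourage_ballE => -[[e e'] /=].
rewrite ltcE /= => /andP[/eqP -> e0 eE].
have e2 : 0 < e / 2 by lra.
have := uS _ e2; apply: filterS => N uSN; apply: EP => z Az; apply: eE.
rewrite /= -ball_normE /= normr_normc ltcR (le_lt_trans (uSN z Az))//; lra.
Qed.

Lemma lim_normc_le (R : realType) (u : nat -> R[i]^o) (l v : R[i]^o) (b : R) :
  u @ \oo --> l -> (\forall N \near \oo, normc (v - u N) <= b) ->
  normc (v - l) <= b.
Proof.
move=> /cvg_normcP ul vu; apply/ler_addgt0Pr => e e0.
have [N [uv1 uv2]] := filter_ex (filterI vu (ul _ e0)).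
by rewrite (le_trans (normc_triangle (u N) _ _))// lerD// normc_distC.
Qed.

(** Completeness of the complex numbers, inherited from [R] through the real
    and imaginary parts. *)
Lemma cauchy_cvg_complex (R : realType) (u : nat -> R[i]^o) :
  (forall e : R, 0 < e ->
     exists N, forall n, (N <= n)%N -> normc (u N - u n) <= e) ->
  exists l : R[i]^o, u @ \oo --> l.
Proof.
move=> uC.
have part (p : R[i]^o -> R) : (forall x y, p (x - y) = p x - p y) ->
    (forall z, `|p z| <= normc z) -> cvg (p \o u @ \oo).
  move=> pB pn; apply/cauchy_cvgP/cauchy_exP => e e0.
  have [|N uN] := uC (e / 2); first by lra.
  exists (p (u N)); exists N => // n /= /uN un; rewrite -ball_normE /=.
  rewrite -pB (le_lt_trans (pn _))// (le_lt_trans un)//; lra.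
have /cvg_ex[x ux] : cvg (Re \o u @ \oo).
  by apply: part => [[? ?] [? ?]//|z]; case: (normc_le_ReIm z).
have /cvg_ex[y uy] : cvg (Im \o u @ \oo).
  by apply: part => [[? ?] [? ?]//|z]; case: (normc_le_ReIm z).
exists (x +i* y)%C; apply/cvg_normcP => e e0.
have e2 : 0 < e / 2 by lra.
have [/cvgrPdist_le/(_ _ e2) ux' /cvgrPdist_le/(_ _ e2) uy'] := (ux, uy).
apply: filterS2 ux' uy' => N /=; case: (u N) => a b /= xa yb.
by have [_ _ /le_trans->//=] := normc_le_ReIm ((x +i* y) - (a +i* b))%C; lra.
Qed.

Lemma geometric_tail_small (R : realType) (B q e : R) :
  0 <= B -> 0 <= q < 1 -> 0 < e ->
  \forall N \near \oo, B * q ^+ N / (1 - q) <= e.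
Proof.
move=> B0 /andP[q0 q1] e0.
have /cvgrPdist_le qn : (fun n => q ^+ n) @ \oo --> (0 : R).
  by apply: cvg_expr; rewrite ger0_norm.
have /qn : 0 < e * (1 - q) / (B + 1) by rewrite divr_gt0// ?mulr_gt0//; lra.
apply: filterS => N; rewrite sub0r normrN ger0_norm ?exprn_ge0//.
rewrite ler_pdivlMr ?ler_pdivrMr; [|lra|lra].
have := exprn_ge0 N q0; nra.
Qed.

(** The one convergence test in use.  The explicit tail bound is what later
    makes convergence uniform: it depends on the terms through [M] and [q]
    only. *)
Lemma geometric_dominated_series (R : realType) (c : nat -> R[i]^o) (M q : R) :
  0 <= q < 1 -> (forall n, normc (c n) <= M * q ^+ n) ->
  exists2 l : R[i]^o, series c @ \oo --> l &
    forall N, normc (l - series c N) <= M * q ^+ N / (1 - q).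
Proof.
move=> /andP[q0 q1] cM.
have M0 : 0 <= M by have := cM 0%N; have := normc_ge0 (c 0%N); rewrite expr0; lra.
have q1' : 1 - q != 0 by lra.
have dist N k : normc (series c N - series c (N + k)%N) <=
    M * (q ^+ N - q ^+ (N + k)) / (1 - q).
  elim: k => [|k IH]; first by rewrite addn0 !subrr normc0 mulr0 mul0r.
  rewrite addnS [series c (N + k).+1]/series/= big_nat_recr//=.
  rewrite opprD addrA (le_trans (le_normcD _ _))// normcN exprS.
  rewrite (le_trans (lerD IH (cM _)))// le_eqVlt; apply/orP; left; apply/eqP.
  by field.
have dist' N n : (N <= n)%N ->
    normc (series c N - series c n) <= M * q ^+ N / (1 - q).
  move=> /subnKC <-; rewrite (le_trans (dist _ _))// ler_pM2r ?invr_gt0 ?subr_gt0//.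
  by rewrite ler_wpM2l// gerBl exprn_ge0.
have [|l cl] := cauchy_cvg_complex (u := series c).
  move=> e e0.
  have q01 : 0 <= q < 1 by rewrite q0.
  have [N MN] := filter_ex (geometric_tail_small M0 q01 e0).
  by exists N => n /dist' /le_trans; apply.
exists l => // N; rewrite normc_distC; apply: (lim_normc_le cl).
by exists N => // n /= /dist'.
Qed.

(** The limit rules [cvgD], [cvgZl_tmp] and [cvgB], stated for [R[i]^o] itself:
    their uses then do not unify the ring [R[i]] with its regular module, a
    conversion that is very slow. *)
Lemma cvgD_complex (R : realType) (u v : nat -> R[i]^o) (a b : R[i]^o) :
  u @ \oo --> a -> v @ \oo --> b -> (fun n => u n + v n) @ \oo --> a + b.
Proof.
move=> /cvg_normcP ua /cvg_normcP vb; apply/cvg_normcP => e e0.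
have e2 : 0 < e / 2 by lra.
apply: filterS2 (ua _ e2) (vb _ e2) => n uan vbn.
by rewrite opprD addrACA (le_trans (le_normcD _ _))//; lra.
Qed.

Lemma cvgZ_complex (R : realType) (u : nat -> R[i]^o) (a k : R[i]^o) :
  u @ \oo --> a -> (fun n => k * u n) @ \oo --> k * a.
Proof.
move=> /cvg_normcP ua; apply/cvg_normcP => e e0.
have k0 := normc_ge0 k.
have /ua : 0 < e / (normc k + 1) by rewrite divr_gt0//; lra.
apply: filterS => n; rewrite ler_pdivlMr -?mulrBr ?normcM; last by lra.
have := normc_ge0 (a - u n); nra.
Qed.

Lemma cvgB_complex (R : realType) (u v : nat -> R[i]^o) (a b : R[i]^o) :
  u @ \oo --> a -> v @ \oo --> b -> (fun n => u n - v n) @ \oo --> a - b.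
Proof.
move=> ua vb; have := cvgD_complex ua (cvgZ_complex (k := -1) vb).
by rewrite mulN1r; under eq_fun do rewrite mulN1r.
Qed.

(** * Power series and their coefficient seminorms *)

Definition power_sum_on (R : realType) (r : R) (c : nat -> R[i]^o)
    (g : R[i]^o -> R[i]^o) :=
  forall z, normc z < r -> series (fun n => c n * z ^+ n) @ \oo --> g z.

(** A bound [M] on the seminorm [sup_n |c_n| rho^n]; the supremum itself, which
    may be infinite, is never formed. *)
Definition weighted_bound (R : realType) (rho : R) (c : nat -> R[i]^o) (M : R) :=
  forall n, normc (c n) * rho ^+ n <= M.

Definition derived_coef (R : realType) (c : nat -> R[i]^o) : nat -> R[i]^o :=
  fun n => n.+1%:R * c n.+1.

Lemma open_diskE (R : realType) (r : R) (z : R[i]^o) :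
  open_disk r z = (normc z < r) :> Prop.
Proof. by rewrite /open_disk /= normr_normc ltcR. Qed.

Lemma closed_diskE (R : realType) (r : R) (z : R[i]^o) :
  closed_disk r z = (normc z <= r) :> Prop.
Proof. by rewrite /closed_disk /= normr_normc lecR. Qed.

Lemma weighted_bound_ge0 (R : realType) (rho : R) (c : nat -> R[i]^o) (M : R) :
  weighted_bound rho c M -> 0 <= M.
Proof. by move=> /(_ 0%N); rewrite expr0 mulr1; apply: le_trans (normc_ge0 _). Qed.

Lemma weighted_term_le (R : realType) (rho t : R) (c : nat -> R[i]^o) (M : R)
    (n : nat) :
  0 < rho -> 0 <= t -> weighted_bound rho c M ->
  normc (c n) * t ^+ n <= M * (t / rho) ^+ n.
Proof.
move=> rho0 t0 cM; rewrite expr_div_n mulrA ler_pdivlMr ?exprn_gt0// mulrAC.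
by rewrite ler_wpM2r// exprn_ge0.
Qed.

Lemma pseries_tail (R : realType) (rho t : R) (c : nat -> R[i]^o) (M : R)
    (z l : R[i]^o) :
  t < rho -> weighted_bound rho c M -> normc z <= t ->
  series (fun n => c n * z ^+ n) @ \oo --> l -> forall N,
  normc (l - series (fun n => c n * z ^+ n) N)
    <= M * (t / rho) ^+ N / (1 - t / rho).
Proof.
move=> trho cM zt cl.
have t0 : 0 <= t := le_trans (normc_ge0 z) zt.
have rho0 : 0 < rho by lra.
have q01 : 0 <= t / rho < 1 by rewrite divr_ge0 ?ltr_pdivrMr//; lra.
have [n|l' cl' tail] :=
    @geometric_dominated_series _ (fun n => c n * z ^+ n) M _ q01.
  rewrite normcM normcX (le_trans _ (weighted_term_le n rho0 t0 cM))//.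
  by rewrite ler_wpM2l ?normc_ge0// lerXn2r// ?nnegrE ?normc_ge0.
by rewrite (cvg_unique _ cl cl').
Qed.

Lemma pseries_cvg (R : realType) (rho : R) (c : nat -> R[i]^o) (M : R)
    (z : R[i]^o) :
  weighted_bound rho c M -> normc z < rho ->
  exists l : R[i]^o, series (fun n => c n * z ^+ n) @ \oo --> l.
Proof.
move=> cM zrho; have z0 := normc_ge0 z; have rho0 : 0 < rho by lra.
have q01 : 0 <= normc z / rho < 1 by rewrite divr_ge0 ?ltr_pdivrMr//; lra.
have [n|l cl _] :=
    @geometric_dominated_series _ (fun n => c n * z ^+ n) M _ q01.
  by rewrite normcM normcX weighted_term_le.
by exists l.
Qed.

Lemma cvg_series_weighted_bound (R : realType) (rho : R) (c : nat -> R[i]^o)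
    (l : R[i]^o) :
  0 <= rho -> series (fun n => c n * rho%:C ^+ n) @ \oo --> l ->
  exists M, weighted_bound rho c M.
Proof.
move=> rho0 /cvg_normcP/(_ 1 ltr01)[N _ cl].
exists (2 + \sum_(i < N) normc (c i) * rho ^+ i) => n.
have term0 i : 0 <= normc (c i) * rho ^+ i by rewrite mulr_ge0 ?normc_ge0 ?exprn_ge0.
have [nN|Nn] := ltnP n N.
  rewrite (bigD1 (Ordinal nN))//= addrCA lerDl addr_ge0 ?sumr_ge0//; lra.
rewrite ler_wpDr ?sumr_ge0//.
have -> : normc (c n) * rho ^+ n = normc (c n * rho%:C ^+ n).
  by rewrite normcM normcX normc_real.
have [ln lSn] := (cl n Nn, cl n.+1 (leqW Nn)).
pose s := series (fun n => c n * rho%:C ^+ n).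
have -> : c n * rho%:C ^+ n = s n.+1 - s n.
  by rewrite /s /series /= big_nat_recr//= addrAC subrr add0r.
rewrite (le_trans (normc_triangle l _ _))// normc_distC.
have : normc (l - s n.+1) + normc (l - s n) <= 1 + 1 by exact: lerD.
lra.
Qed.

(** The factor [n + 1] lost in a differentiation is absorbed by any increase of
    the radius: this is Cauchy's estimate for the derivative of [z ^ (n + 1)] on
    a disk of radius [rho - t] around a point of modulus [t]. *)
Lemma growth_bound (R : realType) (rho t : R) n : 0 <= t <= rho ->
  n.+1%:R * t ^+ n * (rho - t) <= rho ^+ n.+1.
Proof.
move=> /andP[t0 trho]; elim: n => [|n IH]; first by rewrite expr0 expr1; lra.
have tn : t ^+ n.+1 <= rho ^+ n.+1 by rewrite lerXn2r// nnegrE; lra.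
have -> : n.+2%:R * t ^+ n.+1 * (rho - t) =
   t * (n.+1%:R * t ^+ n * (rho - t)) + t ^+ n.+1 * (rho - t).
  by rewrite -[n.+2]addn1 natrD exprS; ring.
rewrite [rho ^+ n.+2]exprS; nra.
Qed.

Lemma weighted_bound_derived (R : realType) (rho t : R) (c : nat -> R[i]^o) (M : R) :
  0 <= t < rho -> weighted_bound rho c M ->
  weighted_bound t (derived_coef c) (M / (rho - t)).
Proof.
move=> /andP[t0 trho] cM n; rewrite /derived_coef normcM normc_nat.
rewrite ler_pdivlMr ?subr_gt0// (le_trans _ (cM n.+1))//.
have := @growth_bound _ rho t n; rewrite t0 ltW// => /(_ isT).
have := normc_ge0 (c n.+1); nra.
Qed.

(** The second-order Taylor remainder [e_n] of [z ^ n] satisfies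
    [e_(n+1) = w e_n + n (w - z)^2 z^(n-1)]; with [growth_bound] this recursion
    keeps [|e_n| (rho - t)^2] below [|w - z|^2 rho^n].  A bound geometric in [n]
    is what can be summed against the coefficients. *)
Lemma monomial_remainder (R : realType) (rho t : R) (z w : R[i]^o) (n : nat) :
  t <= rho -> normc z <= t -> normc w <= t ->
  normc (w ^+ n - z ^+ n - (w - z) * (n%:R * z ^+ n.-1)) * (rho - t) ^+ 2
    <= normc (w - z) ^+ 2 * rho ^+ n.
Proof.
move=> trho zt wt; have t0 : 0 <= t := le_trans (normc_ge0 z) zt.
elim: n => [|n IH].
  by rewrite !expr0 subrr mul0r mulr0 subr0 normc0 mul0r mulr1 sqr_ge0.
set e := (X in normc X * _ <= _) in IH.
have -> : w ^+ n.+1 - z ^+ n.+1 - (w - z) * (n.+1%:R * z ^+ n.+1.-1) =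
    w * e + (w - z) ^+ 2 * (n%:R * z ^+ n.-1).
  rewrite /e -[n.+1]addn1 natrD addn1 /= !exprS.
  by case: n {IH e} => [|n] /=; rewrite ?exprS; ring.
have step : normc (n%:R * z ^+ n.-1) * (rho - t) <= rho ^+ n.
  case: n {IH e} => [|n] /=; first by rewrite mul0r normc0 mul0r.
  rewrite normcM normc_nat normcX.
  apply: le_trans (@growth_bound _ rho t n _); last by rewrite t0.
  by rewrite ler_wpM2r ?subr_ge0// ler_wpM2l// lerXn2r// nnegrE// normc_ge0.
set X := (X in normc X * (rho - t)) in step.
have H0 : 0 <= normc (w - z) ^+ 2 by rewrite sqr_ge0.
have d0 : 0 <= rho - t by rewrite subr_ge0.
apply: (@le_trans _ _
    ((t * normc e + normc (w - z) ^+ 2 * normc X) * (rho - t) ^+ 2)).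
  rewrite ler_wpM2r ?sqr_ge0// (le_trans (le_normcD _ _))// !normcM.
  by rewrite -expr2 lerD2r ler_wpM2r// normc_ge0.
have -> : normc (w - z) ^+ 2 * rho ^+ n.+1 = t * (normc (w - z) ^+ 2 * rho ^+ n)
    + normc (w - z) ^+ 2 * rho ^+ n * (rho - t) by rewrite [rho ^+ n.+1]exprS; ring.
rewrite mulrDl lerD//.
  by rewrite -mulrA ler_wpM2l.
by rewrite [(rho - t) ^+ 2]expr2 mulrA ler_wpM2r// -mulrA ler_wpM2l.
Qed.

Lemma derived_series_cvg (R : realType) (c : nat -> R[i]^o) (z l : R[i]^o) :
  series (fun n => derived_coef c n * z ^+ n) @ \oo --> l ->
  series (fun n => c n * (n%:R * z ^+ n.-1)) @ \oo --> l.
Proof.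
move=> cl; rewrite -cvg_shiftS; apply: cvg_trans cl; apply: near_eq_cvg.
near=> N.
rewrite /series /= big_nat_recl//= mul0r mulr0 add0r.
by apply: eq_bigr => i _; rewrite /derived_coef; ring.
Unshelve. all: by end_near. Qed.

(** Summing [monomial_remainder] against [c]: the difference of the sum at two
    points is linear up to a quadratic error, uniformly in the disk of radius
    [t].  The radius [rho'] is where the coefficients are controlled, and
    [rho < rho'] makes the dominating series geometric. *)
Lemma pseries_remainder (R : realType) (rho' rho t : R) (c : nat -> R[i]^o) (M : R)
    (z w gz gw dz : R[i]^o) :
  t < rho < rho' -> weighted_bound rho' c M -> normc z <= t -> normc w <= t ->
  series (fun n => c n * z ^+ n) @ \oo --> gz ->
  series (fun n => c n * w ^+ n) @ \oo --> gw ->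
  series (fun n => derived_coef c n * z ^+ n) @ \oo --> dz ->
  normc (gw - gz - (w - z) * dz) <=
    M / (rho - t) ^+ 2 / (1 - rho / rho') * normc (w - z) ^+ 2.
Proof.
move=> /andP[trho rho'rho] cM zt wt cz cw /derived_series_cvg cd.
have t0 : 0 <= t := le_trans (normc_ge0 z) zt.
have q01 : 0 <= rho / rho' < 1 by rewrite divr_ge0 ?ltr_pdivrMr//; lra.
pose d n := c n * (w ^+ n - z ^+ n - (w - z) * (n%:R * z ^+ n.-1)).
have [n|l dl /(_ 0%N)] := @geometric_dominated_series _ d
    (M * normc (w - z) ^+ 2 / (rho - t) ^+ 2) _ q01.
  rewrite /d normcM mulrAC ler_pdivlMr ?exprn_gt0 ?subr_gt0// -mulrA.
  apply: (@le_trans _ _ (normc (c n) * (normc (w - z) ^+ 2 * rho ^+ n))).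
    by rewrite ler_wpM2l ?normc_ge0// monomial_remainder// ltW.
  rewrite mulrCA mulrC [leRHS]mulrAC ler_wpM2r ?sqr_ge0// weighted_term_le//; lra.
have sumd : series d @ \oo --> gw - gz - (w - z) * dz.
  rewrite (_ : series d = fun N => series (fun n => c n * w ^+ n) N -
      series (fun n => c n * z ^+ n) N -
      (w - z) * series (fun n => c n * (n%:R * z ^+ n.-1)) N).
    exact: (cvgB_complex (cvgB_complex cw cz) (cvgZ_complex cd)).
  apply/funext => N; rewrite /series /= mulr_sumr -!sumrB.
  by apply: eq_bigr => i _; rewrite /d; ring.
rewrite (cvg_unique _ dl sumd)//.
rewrite {1}/series /= big_geq// subr0 expr0 mulr1.
by move=> /le_trans; apply; rewrite le_eqVlt; apply/orP; left; apply/eqP; ring.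
Qed.

(** * Termwise differentiation *)

Lemma quadratic_is_derive (R : realType) (g : R[i]^o -> R[i]^o) (z d : R[i]^o)
    (delta K : R) :
  0 < delta ->
  (forall w, normc (w - z) <= delta ->
     normc (g w - g z - (w - z) * d) <= K * normc (w - z) ^+ 2) ->
  derivable g z 1 /\ g^`() z = d.
Proof.
move=> delta0 gd.
have K0 : 0 <= K.
  have := gd (z + delta%:C); rewrite addrAC subrr add0r (normc_real (ltW delta0)).
  move=> /(_ (lexx _))/(le_trans (normc_ge0 _)).
  by rewrite pmulr_lge0 ?exprn_gt0.
have quot : (fun h : R[i]^o =>
    h^-1 *: ((g \o shift z) (h *: (1 : R[i]^o)) - g z)) @ (0 : R[i]^o)^' --> d.
  apply/cvgrPdist_le => -[e e']; rewrite ltcE /= => /andP[/eqP -> e0].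
  pose eta := Num.min delta (e / (K + 1)).
  have eta0 : 0 < eta by rewrite lt_min delta0 divr_gt0//; lra.
  rewrite /dnbhs /within /=.
  apply/nbhs_ballP; exists eta%:C => /=; first by rewrite ltcR.
  move=> h; rewrite -ball_normE /= sub0r normrN normr_normc ltcR.
  rewrite lt_min => /andP[hdelta he] h0.
  have -> : h *: (1 : R[i]^o) = h by rewrite /GRing.scale /= mulr1.
  have hn0 : 0 < normc h.
    rewrite lt_neqAle normc_ge0 andbT eq_sym; apply/negP => /eqP.
    by move/ComplexField.Normc.eq0_normc/eqP; rewrite (negbTE h0).
  have := gd (h + z); rewrite addrK => /(_ (ltW hdelta)).
  rewrite normr_normc lecR => gh.
  have -> : d - h^-1 *: (g (h + z) - g z) = - (h^-1 * (g (h + z) - g z - h * d)).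
    by rewrite /GRing.scale /=; field.
  rewrite normcN normcM ComplexField.Normc.normcV mulrC ler_pdivrMr//.
  rewrite (le_trans gh)// [normc h ^+ 2]expr2 mulrA ler_wpM2r ?normc_ge0//.
  move: he; rewrite ltr_pdivlMr; last by lra.
  nra.
split; first by apply/cvg_ex; exists d.
by rewrite derive1E /derive; apply: cvg_lim.
Qed.

Lemma power_sum_on_bound (R : realType) (r : R) (c : nat -> R[i]^o)
    (g : R[i]^o -> R[i]^o) (rho : R) :
  power_sum_on r c g -> 0 <= rho < r -> exists M, weighted_bound rho c M.
Proof.
move=> cg /andP[rho0 rhor].
by apply: (cvg_series_weighted_bound rho0 (cg rho%:C _)); rewrite normc_real.
Qed.

Lemma power_sum_on_derive (R : realType) (r : R) (c : nat -> R[i]^o)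
    (g : R[i]^o -> R[i]^o) :
  power_sum_on r c g ->
  (forall z, normc z < r -> derivable g z 1) /\
  power_sum_on r (derived_coef c) g^`().
Proof.
move=> cg.
suff main z : normc z < r -> derivable g z 1 /\
    series (fun n => derived_coef c n * z ^+ n) @ \oo --> g^`() z.
  by split=> z /main[].
move=> zr; have z0 := normc_ge0 z.
(* Equally spaced radii between [normc z] and [r]: [s 1] for the points near
   [z], [s 2] for the geometric majorant, [s 3] for the coefficients. *)
pose s k : R := normc z + k%:R * ((r - normc z) / 4%:R).
have sE : [/\ normc z < s 1, s 1 < s 2, s 2 < s 3 & s 3 < r].
  by rewrite /s; split; lra.
have [zs1 s12 s23 s3r] := sE.
have [|M cM] := power_sum_on_bound (rho := s 3) cg; first by lra.
have cM' : weighted_bound (s 2) (derived_coef c) (M / (s 3 - s 2)).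
  by apply: weighted_bound_derived cM; lra.
have [|d cd] := pseries_cvg (z := z) cM'; first by lra.
have [] := @quadratic_is_derive _ g z d (s 1 - normc z)
    (M / (s 2 - s 1) ^+ 2 / (1 - s 2 / s 3)); first by lra.
  move=> w wz.
  have ws1 : normc w <= s 1.
    rewrite -(subrK z w) (le_trans (le_normcD _ _))//; lra.
  have wr : normc w < r by rewrite (le_lt_trans ws1)//; lra.
  by apply: (pseries_remainder _ cM _ ws1 (cg z zr) (cg w wr) cd); lra.
move=> gz ->; exact: (conj gz cd).
Qed.

Lemma power_sum_on_derive1n (R : realType) (r : R) (c : nat -> R[i]^o)
    (g : R[i]^o -> R[i]^o) (k : nat) :
  power_sum_on r c g -> power_sum_on r (iter k (@derived_coef R) c) g^`(k).
Proof.
move=> cg; elim: k => [//|k IH].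
by rewrite derive1nS iterS; case: (power_sum_on_derive IH).
Qed.

(** * Cauchy's estimate by averaging over roots of unity *)

(** Orders that are powers of [2] are unbounded, which is all that the averaging
    needs, and are the easiest to reach: if [w ^ (2 ^ s) = -1], the order of [w]
    divides [2 ^ (s + 1)] but not [2 ^ s]. *)
Lemma pow2_primitive_root (C : numClosedFieldType) (s : nat) :
  exists w : C, (2 ^ s.+1).-primitive_root w.
Proof.
have pos : (0 < 2 ^ s)%N by rewrite expn_gt0.
pose w : C := (2 ^ s).-root (-1).
have w1 : w ^+ (2 ^ s) = -1 by rewrite /w rootCK.
have w2 : w ^+ (2 ^ s.+1) = 1 by rewrite expnSr exprM w1 sqrrN expr1n.
have [|k wk] := prim_order_exists _ w2; first by rewrite expn_gt0.
move=> /dvdn_pfactor[//|e es1 kE]; exists w; rewrite kE in wk.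
suff -> : s.+1 = e by [].
apply/eqP; rewrite eqn_leq es1 andbT ltnNge; apply/negP => es.
move: w1; rewrite -(subnKC es) expnD exprM (prim_expr_order wk) expr1n => /eqP.
by rewrite -subr_eq0 opprK -(natrD _ 1 1) pnatr_eq0.
Qed.

Lemma sum_root_of_unity (C : fieldType) (m d : nat) (w : C) :
  m.-primitive_root w -> ~~ (m %| d)%N -> \sum_(j < m) (w ^+ d) ^+ j = 0.
Proof.
move=> wm md; have wd1 : w ^+ d - 1 != 0.
  by rewrite subr_eq0 -(prim_order_dvd wm).
apply: (mulfI wd1); rewrite mulr0 -subrX1 -exprM mulnC exprM.
by rewrite (prim_expr_order wm) expr1n subrr.
Qed.

(** Averaging [p (rho w^j) w^(-nj)] over [j] isolates the coefficient of index
    [n], because [w ^ (i - n)] is a nontrivial root of unity for the other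
    indices [i]. *)
Lemma cauchy_estimate_poly (R : realType) (c : nat -> R[i]^o) (m : nat)
    (rho M : R) :
  0 <= rho ->
  (forall z : R[i]^o, normc z = rho -> normc (\sum_(i < m) c i * z ^+ i) <= M) ->
  forall n, (n < m)%N -> normc (c n) * rho ^+ n <= M.
Proof.
move=> rho0 cM n nm; have [w wK] := pow2_primitive_root R[i] m.
set K := (2 ^ m.+1)%N in wK.
have mK : (m < K)%N by rewrite ltnW// ltn_expl.
have w1 : normc (w : R[i]^o) = 1.
  apply/eqP; rewrite -(@pexpr_eq1 _ _ K) ?normc_ge0//; last exact: leq_ltn_trans mK.
  by rewrite -normcX (prim_expr_order wK) ComplexField.Normc.normc1.
pose p (z : R[i]^o) := \sum_(i < m) c i * z ^+ i.
(* [K - n] stands for the exponent [-n], as [w ^+ K = 1]. *)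
have term (i j : nat) : c i * (rho%:C * w ^+ j) ^+ i * w ^+ ((K - n) * j) =
    c i * rho%:C ^+ i * (w ^+ (i + (K - n))) ^+ j.
  by rewrite exprMn -!exprM -!mulrA -exprD (mulnC j) -mulnDl.
have avg : K%:R * (c n * rho%:C ^+ n) =
    \sum_(j < K) p (rho%:C * w ^+ j) * w ^+ ((K - n) * j).
  under eq_bigr do rewrite /p mulr_suml.
  rewrite exchange_big /= (bigD1 (Ordinal nm)) //= [X in _ + X]big1 ?addr0.
    under eq_bigr do rewrite term subnKC 1?(ltnW (ltn_trans nm mK))//.
    under eq_bigr do rewrite (prim_expr_order wK) expr1n mulr1.
    by rewrite sumr_const card_ord mulr_natl.
  move=> i ni; under eq_bigr do rewrite term.
  rewrite -mulr_sumr (sum_root_of_unity wK) ?mulr0//.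
  have im := ltn_ord i; have {}ni : (i : nat) != n by [].
  by apply/dvdnP => -[[|[|q]]]; nia.
have K0 : 0 < K%:R :> R by rewrite ltr0n expn_gt0.
rewrite -(ler_pM2l K0).
have -> : K%:R * (normc (c n) * rho ^+ n) = normc (K%:R * (c n * rho%:C ^+ n)).
  by rewrite !normcM normcX normc_real// normc_nat.
rewrite avg (le_trans (normc_sum _ _))//.
rewrite [leRHS]mulr_natl -[X in _ *+ X](card_ord K) -sumr_const ler_sum// => j _.
rewrite normcM normcX w1 expr1n mulr1 cM//.
by rewrite normcM normcX w1 expr1n mulr1 normc_real.
Qed.

(** A truncation of [g] is within [e] of [g] on the circle of radius [rho], so
    the estimate for polynomials holds for [g] up to every [e > 0]. *)
Lemma cauchy_estimate (R : realType) (r rho M : R) (c : nat -> R[i]^o)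
    (g : R[i]^o -> R[i]^o) :
  power_sum_on r c g -> 0 <= rho < r ->
  (forall z, normc z <= rho -> normc (g z) <= M) -> weighted_bound rho c M.
Proof.
move=> cg /andP[rho0 rhor] gM n.
have [|B cB] := power_sum_on_bound (rho := (rho + r) / 2) cg; first by lra.
have rho' : rho < (rho + r) / 2 by lra.
set q := rho / ((rho + r) / 2).
have q1 : 0 <= q < 1 by rewrite /q divr_ge0 ?ltr_pdivrMr//; lra.
apply/ler_addgt0Pr => e e0.
have [N _ small] := geometric_tail_small (weighted_bound_ge0 cB) q1 e0.
(* Long enough for the truncation to be close to [g] and to contain [c n]. *)
pose m := maxn N n.+1.
apply: (@cauchy_estimate_poly _ _ m) => //; last by rewrite leq_max ltnSn orbT.
move=> z zrho; have zle : normc z <= rho by rewrite zrho.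
have := pseries_tail rho' cB zle (cg z (le_lt_trans zle rhor)) m.
rewrite -/q {1}/series /= big_mkord => tail.
set S := \sum_(i < m) _ in tail *.
have -> : S = g z - (g z - S) by rewrite opprB addrC subrK.
rewrite (le_trans (le_normcD _ _))// normcN lerD ?gM// (le_trans tail)//.
by apply: small; rewrite /= leq_maxl.
Qed.

(** * Convergence of coefficient sequences *)

(** Convergence in all the seminorms [sup_n |c_n| rho^n], [rho < r]: this is
    locally uniform convergence on the disk of radius [r], seen on the
    coefficients. *)
Definition coef_cvg (R : realType) (r : R) (C : nat -> nat -> R[i]^o)
    (c : nat -> R[i]^o) :=
  forall rho, 0 < rho < r -> forall e, 0 < e ->
    \forall N \near \oo, weighted_bound rho (fun n => c n - C N n) e.

Lemma power_sum_onB (R : realType) (r : R) (c d : nat -> R[i]^o)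
    (g h : R[i]^o -> R[i]^o) :
  power_sum_on r c g -> power_sum_on r d h ->
  power_sum_on r (fun n => c n - d n) (fun z => g z - h z).
Proof.
move=> cg dh z zr; have := cvgB_complex (cg z zr) (dh z zr).
rewrite (_ : (fun N => _ - _) = series (fun n => (c n - d n) * z ^+ n))//.
apply/funext => N; rewrite /series /= -sumrB.
by apply: eq_bigr => i _; rewrite mulrBl.
Qed.

Lemma power_sum_onD (R : realType) (r : R) (c d : nat -> R[i]^o)
    (g h : R[i]^o -> R[i]^o) :
  power_sum_on r c g -> power_sum_on r d h ->
  power_sum_on r (fun n => c n + d n) (fun z => g z + h z).
Proof.
move=> cg dh z zr; have := cvgD_complex (cg z zr) (dh z zr).
rewrite (_ : (fun N => _ + _) = series (fun n => (c n + d n) * z ^+ n))//.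
apply/funext => N; rewrite /series /= -big_split /=.
by apply: eq_bigr => i _; rewrite mulrDl.
Qed.

Lemma power_sum_on_sum (R : realType) (r : R) (c : nat -> nat -> R[i]^o)
    (g : nat -> R[i]^o -> R[i]^o) (N : nat) :
  (forall mu, power_sum_on r (c mu) (g mu)) ->
  power_sum_on r (fun n => \sum_(0 <= mu < N) c mu n)
    (fun z => \sum_(0 <= mu < N) g mu z).
Proof.
move=> cg; elim: N => [|N IH].
  move=> z zr; rewrite big_geq// (_ : series _ = fun=> 0); first exact: cvg_cst.
  apply/funext => n; rewrite /series /= big1// => i _.
  by rewrite big_geq// mul0r.
have recr (u : nat -> R[i]^o) :
    \sum_(0 <= mu < N.+1) u mu = \sum_(0 <= mu < N) u mu + u N.
  by rewrite big_nat_recr.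
have -> : (fun n => \sum_(0 <= mu < N.+1) c mu n) =
  (fun n => \sum_(0 <= mu < N) c mu n + c N n) by apply/funext => n; exact: recr.
have -> : (fun z => \sum_(0 <= mu < N.+1) g mu z) =
  (fun z => \sum_(0 <= mu < N) g mu z + g N z) by apply/funext => n; exact: recr.
exact: power_sum_onD IH (cg N).
Qed.

Lemma iter_derived_sum (R : realType) (c : nat -> nat -> R[i]^o) (N k : nat) :
  iter k (@derived_coef R) (fun n => \sum_(0 <= mu < N) c mu n) =
  (fun n => \sum_(0 <= mu < N) iter k (@derived_coef R) (c mu) n).
Proof.
elim: k => [//|k IH]; rewrite iterS IH; apply/funext => n.
by rewrite /derived_coef mulr_sumr.
Qed.

(** A seminorm of the derived error at [rho] is controlled by a seminorm of the
    error at a radius strictly between [rho] and [r]. *)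
Lemma coef_cvg_derived (R : realType) (r : R) (C : nat -> nat -> R[i]^o)
    (c : nat -> R[i]^o) :
  coef_cvg r C c ->
  coef_cvg r (fun N => derived_coef (C N)) (derived_coef c).
Proof.
move=> Cc rho /andP[rho0 rhor] e e0.
pose rho' := (rho + r) / 2.
have rho'_gt : rho < rho' by rewrite /rho'; lra.
have rho'r : 0 < rho' < r by rewrite /rho'; lra.
have e'0 : 0 < e * (rho' - rho) by rewrite mulr_gt0 ?subr_gt0.
apply: filterS (Cc _ rho'r _ e'0) => N CN n.
have rho01 : 0 <= rho < rho' by rewrite rho'_gt ltW.
have := weighted_bound_derived rho01 CN n.
by rewrite mulfK ?subr_eq0 ?gt_eqF// /derived_coef mulrBr.
Qed.

Lemma coef_cvg_iter_derived (R : realType) (r : R) (C : nat -> nat -> R[i]^o)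
    (c : nat -> R[i]^o) (k : nat) :
  coef_cvg r C c ->
  coef_cvg r (fun N => iter k (@derived_coef R) (C N))
    (iter k (@derived_coef R) c).
Proof. by move=> Cc; elim: k => [//|k]; exact: coef_cvg_derived. Qed.

(** The error is itself a power series whose coefficients are small in the
    seminorm of a larger radius [rho']; its sum on the closed disk of radius
    [rho] is at most that seminorm times the sum of the powers of
    [rho / rho']. *)
Lemma coef_cvg_uniform (R : realType) (r rho e : R) (C : nat -> nat -> R[i]^o)
    (c : nat -> R[i]^o) (G : nat -> R[i]^o -> R[i]^o) (g : R[i]^o -> R[i]^o) :
  coef_cvg r C c -> (forall N, power_sum_on r (C N) (G N)) ->
  power_sum_on r c g -> 0 <= rho < r -> 0 < e ->
  \forall N \near \oo, forall z, normc z <= rho -> normc (g z - G N z) <= e.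
Proof.
move=> Cc CG cg /andP[rho0 rhor] e0.
pose rho' := (rho + r) / 2.
have rho'_gt : rho < rho' by rewrite /rho'; lra.
have q1 : 0 < 1 - rho / rho' by rewrite subr_gt0 ltr_pdivrMr//; lra.
have rho'r : 0 < rho' < r by rewrite /rho'; lra.
have := Cc _ rho'r _ (mulr_gt0 e0 q1); apply: filterS => N CN z zrho.
have zr : normc z < r by lra.
have := pseries_tail rho'_gt CN zrho (power_sum_onB cg (CG N) zr) 0%N.
by rewrite {1}/series /= big_geq// subr0 expr0 mulr1 mulfK ?gt_eqF.
Qed.

Lemma coef_cvg_power_sum (R : realType) (r : R) (C : nat -> nat -> R[i]^o)
    (c : nat -> R[i]^o) (G : nat -> R[i]^o -> R[i]^o) :
  coef_cvg r C c -> (forall N, power_sum_on r (C N) (G N)) ->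
  exists g, power_sum_on r c g.
Proof.
move=> Cc CG; exists (fun z => lim (series (fun n => c n * z ^+ n) @ \oo)) => z zr.
have z0 := normc_ge0 z.
pose rho := (normc z + r) / 2.
have zrho : normc z < rho by rewrite /rho; lra.
have rho0r : 0 < rho < r by rewrite /rho; lra.
have [N CN] := filter_ex (Cc _ rho0r 1 ltr01).
have [|M CM] := power_sum_on_bound (rho := rho) (CG N); first by lra.
have cM : weighted_bound rho c (1 + M).
  move=> n; rewrite -(subrK (C N n) (c n)).
  rewrite (le_trans _ (lerD (CN n) (CM n)))// -mulrDl ler_wpM2r ?le_normcD//.
  by rewrite exprn_ge0//; lra.
by have [l cl] := pseries_cvg cM zrho; apply/cvg_ex; exists l.
Qed.

Lemma uniform_cauchy_coef (R : realType) (r rho e : R) (C : nat -> nat -> R[i]^o)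
    (G : nat -> R[i]^o -> R[i]^o) (S : R[i]^o -> R[i]^o) :
  (forall N, power_sum_on r (C N) (G N)) -> 0 <= rho < r -> 0 < e ->
  (forall e, 0 < e -> \forall N \near \oo,
     forall z, normc z <= rho -> normc (S z - G N z) <= e) ->
  exists N0, forall N M, (N0 <= N)%N -> (N0 <= M)%N ->
    weighted_bound rho (fun n => C N n - C M n) e.
Proof.
move=> CG rho0r e0 GS.
have [|N0 _ GSN] := GS (e / 2); first by lra.
exists N0 => N M N0N N0M.
apply: cauchy_estimate (power_sum_onB (CG N) (CG M)) rho0r _ => z zrho.
rewrite (le_trans (normc_triangle (S z) _ _))// normc_distC.
have := lerD (GSN N N0N z zrho) (GSN M N0M z zrho); lra.
Qed.

(** The converse of [coef_cvg_uniform].  Cauchy's estimate makes the coefficients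
    Cauchy uniformly with respect to the weights; each of them then converges,
    and letting one of the two indices tend to infinity preserves the uniform
    bound. *)
Lemma uniform_cvg_coef_cvg (R : realType) (r : R) (C : nat -> nat -> R[i]^o)
    (G : nat -> R[i]^o -> R[i]^o) :
  0 < r -> (forall N, power_sum_on r (C N) (G N)) ->
  (forall rho, 0 < rho < r -> exists S : R[i]^o -> R[i]^o,
     forall e, 0 < e -> \forall N \near \oo,
     forall z, normc z <= rho -> normc (S z - G N z) <= e) ->
  (forall n, cvg (C ^~ n @ \oo)) /\ coef_cvg r C (fun n => lim (C ^~ n @ \oo)).
Proof.
move=> r0 CG GS.
have CC rho e : 0 < rho < r -> 0 < e -> exists N0, forall N M,
    (N0 <= N)%N -> (N0 <= M)%N -> weighted_bound rho (fun n => C N n - C M n) e.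
  move=> rho0r e0; have [S GS'] := GS _ rho0r.
  by apply: uniform_cauchy_coef CG _ e0 GS'; lra.
have Ccvg n : cvg (C ^~ n @ \oo).
  apply/cvg_ex/cauchy_cvg_complex => e e0.
  have rn0 : 0 < (r / 2) ^+ n by rewrite exprn_gt0//; lra.
  have [||N CN] := CC (r / 2) (e * (r / 2) ^+ n); [lra|exact: mulr_gt0|].
  exists N => m Nm; have := CN N m (leqnn N) Nm n.
  by rewrite ler_pM2r.
split=> // rho rho0r e e0; have [N0 CN] := CC _ _ rho0r e0.
exists N0 => // N /= N0N n; have rhon : 0 < rho ^+ n by rewrite exprn_gt0//; lra.
rewrite -ler_pdivlMr// normc_distC.
apply: (lim_normc_le (u := C ^~ n)); first exact: Ccvg.
by exists N0 => // M /= N0M; rewrite ler_pdivlMr//; exact: CN.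
Qed.

Unset Implicit Arguments.
Set Strict Implicit.

Theorem theorem11p1 (R : realType) (r : R) (r_gt0 : 0 < r)
    (a : nat -> nat -> R[i]^o)
    (f : nat -> R[i]^o -> R[i]^o) (F : R[i]^o -> R[i]^o)
    (f_pseries : forall mu z, open_disk r z ->
       series (fun n => a n mu * z ^+ n) @ \oo --> f mu z)
    (f_unif : forall rho : R, 0 < rho < r ->
       uniformly_summable_on (closed_disk rho) f)
    (F_sum : forall z, open_disk r z -> F z = lim (series (f ^~ z) @ \oo)) :
  [/\ forall n, cvg (series (a n) @ \oo),
      forall z, open_disk r z ->
        series (fun n => lim (series (a n) @ \oo) * z ^+ n) @ \oo --> F z
    & forall rho : R, 0 < rho < r ->
        uniform_sum_on (closed_disk rho)
          (fun n z => lim (series (a n) @ \oo) * z ^+ n) F] /\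
  (forall k : nat,
    [/\ forall mu z, open_disk r z -> derivable (f mu)^`(k) z 1,
        forall z, open_disk r z -> derivable F^`(k) z 1,
        forall z, open_disk r z ->
          series (fun mu => (f mu)^`(k) z) @ \oo --> F^`(k) z
      & forall rho : R, 0 < rho < r ->
          uniform_sum_on (closed_disk rho) (fun mu => (f mu)^`(k)) F^`(k)]).
Proof.
have af mu : power_sum_on r (fun n => a n mu) (f mu).
  by move=> z zr; apply: f_pseries; rewrite open_diskE.
pose C N n := \sum_(0 <= mu < N) a n mu.
have CG N : power_sum_on r (C N) (fun z => series (f ^~ z) N).
  exact: power_sum_on_sum.
have [rho /f_unif[S /uniform_sum_onP fS]|Ccvg Cc] :=
    uniform_cvg_coef_cvg (C := C) r_gt0 CG.
  exists S => e /fS; apply: filterS => N fSN z zrho.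
  by apply: fSN; rewrite closed_diskE.
pose c n := lim (C ^~ n @ \oo).
have [g cg] := coef_cvg_power_sum Cc CG.
(* [g] is the limit of the partial sums given by the coefficients, and [F] is
   their pointwise limit. *)
have cF : power_sum_on r c F.
  move=> z zr; suff -> : F z = g z by exact: cg.
  rewrite F_sum ?open_diskE//; apply: cvg_lim => //; apply/cvg_normcP => e e0.
  have zr' : 0 <= normc z < r by rewrite normc_ge0.
  by have := coef_cvg_uniform Cc CG cg zr' e0; apply: filterS => N; apply.
have iter_sum k N : power_sum_on r (iter k (@derived_coef R) (C N))
    (fun z => series (fun mu => (f mu)^`(k) z) N).
  rewrite iter_derived_sum.
  apply: (@power_sum_on_sum _ _ (fun mu => iter k _ (a ^~ mu))
            (fun mu => (f mu)^`(k))) => mu.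
  exact: (power_sum_on_derive1n (k := k) (af mu)).
have unif k (rho e : R) : 0 <= rho < r -> 0 < e -> \forall N \near \oo,
    forall z, normc z <= rho ->
    normc (F^`(k)%classic z - series (fun mu => (f mu)^`(k)%classic z) N) <= e.
  move=> rhor e0; apply: coef_cvg_uniform (iter_sum k) _ rhor e0.
    exact: coef_cvg_iter_derived Cc.
  exact: (power_sum_on_derive1n (k := k) cF).
split.
  split=> [n|z|rho /andP[rho0 rhor]]; first exact: Ccvg.
    by rewrite open_diskE; apply: cF.
  have [|M cM] := power_sum_on_bound (rho := (rho + r) / 2) cF; first by lra.
  apply/uniform_sum_onP => e e0.
  have q01 : 0 <= rho / ((rho + r) / 2) < 1.
    by rewrite divr_ge0 ?ltr_pdivrMr//; lra.
  apply: filterS (geometric_tail_small (weighted_bound_ge0 cM) q01 e0) => N small z.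
  rewrite closed_diskE => zrho; apply: le_trans small.
  by apply: (pseries_tail _ cM zrho (cF z (le_lt_trans zrho rhor))); lra.
move=> k; split=> [mu z|z|z|rho /andP[rho0 rhor]].
- rewrite open_diskE => zr.
  by have [+ _] := power_sum_on_derive (power_sum_on_derive1n (k := k) (af mu)); apply.
- rewrite open_diskE => zr.
  by have [+ _] := power_sum_on_derive (power_sum_on_derive1n (k := k) cF); apply.
- rewrite open_diskE => zr; apply/cvg_normcP => e e0.
  have zr' : 0 <= normc z < r by rewrite normc_ge0.
  by have := unif k _ _ zr' e0; apply: filterS => N; apply.
- apply/uniform_sum_onP => e e0.
  have rho0r : 0 <= rho < r by rewrite ltW.
  have := unif k _ _ rho0r e0; apply: filterS => N FN z.
  by rewrite closed_diskE => /FN.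
Qed.
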